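(* Let $\Gamma_1$ and $\Gamma_2$ be directed graphs, and let $\Gamma$ be a directed graph with embeddings $f_i:\Gamma\hookrightarrow\Gamma_i$, for $i=1,2$, as a directed subgraph. Suppose given faithful graph weights $(g_i,\lambda_i)$ on the graphs $\Gamma_i$. Consider the graph $\Gamma_1\cup_\Gamma\Gamma_2$ obtained by gluing together the $\Gamma_i$ along the common subgraph $\Gamma$. Then setting $$g(v)=\begin{cases} g_1(v) & v\in V(\Gamma_1)\smallsetminus V(\Gamma)\\ g_2(v) & v\in V(\Gamma_2)\smallsetminus V(\Gamma)\\ g_1(v)+g_2(v) & v\in V(\Gamma)\end{cases}$$ and $$\lambda(e)=\begin{cases}\lambda_1(e) & e\in E(\Gamma_1\smallsetminus\Gamma),\ r(e)\in V(\Gamma_1\smallsetminus\Gamma)\\ \lambda_2(e) & e\in E(\Gamma_2\smallsetminus\Gamma),\ r(e)\in V(\Gamma_2\smallsetminus\Gamma)\\[2mm] \dfrac{\lambda_1(e)g_1(r(e))}{g_1(r(e))+g_2(r(e))} & e\in E(\Gamma_1\smallsetminus\Gamma),\ r(e)\in V(\Gamma)\\[4mm] \dfrac{\lambda_2(e)g_2(r(e))}{g_1(r(e))+g_2(r(e))} & e\in E(\Gamma_2\smallsetminus\Gamma),\ r(e)\in V(\Gamma)\\[4mm] \dfrac{\lambda_1(e)g_1(r(e))+\lambda_2(e)g_2(r(e))}{g_1(r(e))+g_2(r(e))} & e\in E(\Gamma)\end{cases}$$ determines a faithful graph weight $(g,\lambda)$ on the graph $\Gamma_1\cup_\Gamm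a\Gamma_2$.
   Context: For a directed graph $G$, $V(G)$ and $E(G)$ denote its sets of vertices and edges, and $s,r:E(G)\to V(G)$ the source and range maps; a sink is a vertex $v$ with no edge $e$ such that $s(e)=v$. A graph weight on a finite directed graph $G$ is a pair of nonnegative real-valued functions $(g,\lambda)$, with $g$ defined on $V(G)$ and $\lambda$ on $E(G)$, satisfying $g(v)=\sum_{e:\,s(e)=v}\lambda(e)\,g(r(e))$ for each vertex $v$ that is not a sink. It is called faithful if $g$ is never zero. The graph $\Gamma$ is identified with its images in $\Gamma_1$ and $\Gamma_2$ under $f_1$ and $f_2$; $V(\Gamma_i\smallsetminus\Gamma)$ and $E(\Gamma_i\smallsetminus\Gamma)$ denote the vertices and edges of $\Gamma_i$ that are not in $\Gamma$. The graph $\Gamma_1\cup_\Gamma\Gamma_2$ is obtained from the disjoint union of $\Gamma_1$ and $\Gamma_2$ by identifying $f_1(v)$ with $f_2(v)$ for each $v\in V(\Gamma)$ and $f_1(e)$ with $f_2(e)$ for each $e\in E(\Gamma)$.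
   Formalization: Adds the hypothesis that each vertex of Γ is a sink of Γ1 exactly when it is a sink of Γ2; without it the claim fails (Γ = Γ1 a single vertex, Γ2 that vertex with a loop, g1 = g2 = 1, λ2 = 1: the glued graph has g = 2 but λ(e)g(r(e)) = 1). *)

(* Defs.v *)
From HB Require Import structures.
From mathcomp Require Import all_boot all_order all_algebra.
From mathcomp Require Import generic_quotient reals.

Set Implicit Arguments.
Unset Strict Implicit.
Unset Printing Implicit Defensive.

Import GRing.Theory.
Local Open Scope quotient_scope.
Local Open Scope ring_scope.

(* Loops and multiple edges are allowed. *)
Record digraph : Type := Digraph {
  vertex : finType;
  edge : finType;
  src : edge -> vertex;
  rng : edge -> vertex
}.
Arguments src {d}.
Arguments rng {d}.

Definition sink (G : digraph) (v : vertex G) : bool :=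
  ~~ [exists e : edge G, src e == v].

Record embedding (H G : digraph) : Type := Embedding {
  onV : vertex H -> vertex G;
  onE : edge H -> edge G;
  onV_inj : injective onV;
  onE_inj : injective onE;
  onE_src : forall e, src (onE e) = onV (src e);
  onE_rng : forall e, rng (onE e) = onV (rng e)
}.

Definition graph_weight (R : realType) (G : digraph)
    (g : vertex G -> R) (lam : edge G -> R) : Prop :=
  [/\ forall v, 0 <= g v,
      forall e, 0 <= lam e &
      forall v, ~~ sink v -> g v = \sum_(e | src e == v) lam e * g (rng e)].

Definition faithful_graph_weight (R : realType) (G : digraph)
    (g : vertex G -> R) (lam : edge G -> R) : Prop :=
  graph_weight g lam /\ forall v, g v != 0.

(* The quotient of [A + B] by the equivalence relation generated by
   [inl (f1 c) ~ inr (f2 c)]. *)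
Section GluedType.
Variables (C A B : finType) (f1 : C -> A) (f2 : C -> B).

Definition glue_step : rel (A + B) := fun x y => [exists c,
  (x == inl (f1 c)) && (y == inr (f2 c)) ||
  (y == inl (f1 c)) && (x == inr (f2 c))].

Definition glue_rel : rel (A + B) := connect glue_step.

Lemma glue_rel_refl : reflexive glue_rel.
Proof. exact: connect0. Qed.

Lemma glue_rel_sym : symmetric glue_rel.
Proof.
apply: sym_connect_sym => x y; apply/existsP/existsP => -[c Hc];
  by exists c; rewrite orbC.
Qed.

Lemma glue_rel_trans : transitive glue_rel.
Proof. exact: connect_trans. Qed.

Canonical glue_equiv :=
  EquivRel glue_rel glue_rel_refl glue_rel_sym glue_rel_trans.

Definition glued := {eq_quot glue_equiv}.
HB.instance Definition _ := Choice.on glued.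
HB.instance Definition _ := EqQuotient.on glued.
HB.instance Definition _ :=
  Finite.copy glued
    (can_type (@EquivQuot.ereprK _ _ _ _ _ (defaultEncModRel glue_equiv))).

Definition glue_inl (a : A) : glued := \pi_glued (inl a).
Definition glue_inr (b : B) : glued := \pi_glued (inr b).

Inductive glue_part := InLeft of A | InRight of B | InBoth of C.

(* For injective [f1] and [f2] this is the decomposition of [glued] into
   [A \ C], [B \ C] and [C]; outside of [C] the classes are singletons, so the
   choice made by [repr] is immaterial. *)
Definition part (q : glued) : glue_part :=
  if [pick c | glue_inl (f1 c) == q] is Some c then InBoth c
  else match repr q with inl a => InLeft a | inr b => InRight b end.

Lemma glue_inlr c : glue_inl (f1 c) = glue_inr (f2 c).
Proof.
apply/eqmodP; apply: connect1.
by apply/existsP; exists c; rewrite !eqxx.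
Qed.

Lemma glue_ind (P : glued -> Prop) :
  (forall a, P (glue_inl a)) -> (forall b, P (glue_inr b)) -> forall q, P q.
Proof. by move=> Pl Pr; elim/quotW => -[]. Qed.

End GluedType.

Arguments glue_inl {C A B f1 f2}.
Arguments glue_inr {C A B f1 f2}.
Arguments InLeft {C A B}.
Arguments InRight {C A B}.
Arguments InBoth {C A B}.

Section GluedTypeTheory.
Variables (C A B : finType) (f1 : C -> A) (f2 : C -> B).
Hypotheses (f1_inj : injective f1) (f2_inj : injective f2).

Let key (x : A + B) : C + (A + B) :=
  match x with
  | inl a => if [pick c | f1 c == a] is Some c then inl c else inr (inl a)
  | inr b => if [pick c | f2 c == b] is Some c then inl c else inr (inr b)
  end.

Let pick_inj (T : eqType) (f : C -> T) (f_inj : injective f) c :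
  [pick c' | f c' == f c] = Some c.
Proof. by case: pickP => [c' /eqP/f_inj-> //|/(_ c)]; rewrite eqxx. Qed.

Let keyP x y : glue_rel f1 f2 x y -> key x = key y.
Proof.
case/connectP => p; elim: p x => [|z p IH] x /= => [_ -> //|].
case/andP => xz pzp lastp; rewrite -(IH _ pzp lastp).
case/existsP: xz => c /orP[] /andP[/eqP-> /eqP->];
  by rewrite /= !pick_inj.
Qed.

Let keyE x y : \pi_(glued f1 f2) x = \pi_(glued f1 f2) y -> key x = key y.
Proof. by move/eqmodP => /keyP. Qed.

Lemma part_both c : part (glue_inl (f1 c) : glued f1 f2) = InBoth c.
Proof.
rewrite /part; case: pickP => [c' /eqP/keyE|/(_ c)]; last by rewrite eqxx.
by rewrite /= !(pick_inj f1_inj) => -[->].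
Qed.

Lemma part_left a : a \notin codom f1 ->
  part (glue_inl a : glued f1 f2) = InLeft a.
Proof.
move=> aC; have ka : key (inl a) = inr (inl a).
  by rewrite /=; case: pickP => // c /eqP ca; rewrite -ca codom_f in aC.
rewrite /part; case: pickP => [c /eqP/keyE|_].
  by rewrite ka /= (pick_inj f1_inj).
have /esym/keyE := reprK (glue_inl a : glued f1 f2); rewrite ka.
by case: (repr _) => [a'|b'] /=; case: pickP => [c _|_] // [->].
Qed.

Lemma part_right b : b \notin codom f2 ->
  part (glue_inr b : glued f1 f2) = InRight b.
Proof.
move=> bC; have kb : key (inr b) = inr (inr b).
  by rewrite /=; case: pickP => // c /eqP cb; rewrite -cb codom_f in bC.
rewrite /part; case: pickP => [c /eqP/keyE|_].
  by rewrite kb /= pick_inj.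
have /esym/keyE := reprK (glue_inr b : glued f1 f2); rewrite kb.
by case: (repr _) => [a'|b'] /=; case: pickP => [c _|_] // [->].
Qed.

End GluedTypeTheory.

Section GluedGraph.
Variables (G G1 G2 : digraph) (f1 : embedding G G1) (f2 : embedding G G2).

Local Notation glued_vertex := (glued (onV f1) (onV f2)).
Local Notation glued_edge := (glued (onE f1) (onE f2)).

Definition glued_src (e : glued_edge) : glued_vertex :=
  match repr e with
  | inl e1 => glue_inl (src e1)
  | inr e2 => glue_inr (src e2)
  end.

Definition glued_rng (e : glued_edge) : glued_vertex :=
  match repr e with
  | inl e1 => glue_inl (rng e1)
  | inr e2 => glue_inr (rng e2)
  end.

Definition glued_graph : digraph := Digraph glued_src glued_rng.

Let glued_lift (k1 : edge G1 -> vertex G1) (k2 : edge G2 -> vertex G2)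
    (k : edge G -> vertex G) :
  (forall e, k1 (onE f1 e) = onV f1 (k e)) ->
  (forall e, k2 (onE f2 e) = onV f2 (k e)) ->
  let K x : glued_vertex :=
    match x with inl e => glue_inl (k1 e) | inr e => glue_inr (k2 e) end in
  forall x, K (repr (\pi_glued_edge x)) = K x.
Proof.
move=> k1E k2E K x.
have /eqmodP/connectP[p] : repr (\pi_glued_edge x) = x %[mod glued_edge].
  exact: reprK.
elim: p (repr _) => [|z p IH] y /= => [_ -> //|].
case/andP => yz pzp lastp; rewrite -(IH _ pzp lastp).
by case/existsP: yz => e /orP[] /andP[/eqP-> /eqP->];
  rewrite /K k1E k2E glue_inlr.
Qed.

Lemma glued_src_inl e : glued_src (glue_inl e) = glue_inl (src e).
Proof. exact: (glued_lift (onE_src f1) (onE_src f2) (inl e)). Qed.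

Lemma glued_src_inr e : glued_src (glue_inr e) = glue_inr (src e).
Proof. exact: (glued_lift (onE_src f1) (onE_src f2) (inr e)). Qed.

Lemma glued_rng_inl e : glued_rng (glue_inl e) = glue_inl (rng e).
Proof. exact: (glued_lift (onE_rng f1) (onE_rng f2) (inl e)). Qed.

Lemma glued_rng_inr e : glued_rng (glue_inr e) = glue_inr (rng e).
Proof. exact: (glued_lift (onE_rng f1) (onE_rng f2) (inr e)). Qed.

Section Weight.
Variables (R : realType).
Variables (g1 : vertex G1 -> R) (lam1 : edge G1 -> R).
Variables (g2 : vertex G2 -> R) (lam2 : edge G2 -> R).

Definition glued_g (v : vertex glued_graph) : R :=
  match part v with
  | InLeft v1 => g1 v1
  | InRight v2 => g2 v2
  | InBoth w => g1 (onV f1 w) + g2 (onV f2 w)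
  end.

(* The [pick]s decide whether the range of the edge is in [G], and if so return
   it as a vertex [w] of [G]. *)
Definition glued_lam (e : edge glued_graph) : R :=
  match part e with
  | InLeft e1 =>
      if [pick w | onV f1 w == rng e1] is Some w
      then lam1 e1 * g1 (onV f1 w) / (g1 (onV f1 w) + g2 (onV f2 w))
      else lam1 e1
  | InRight e2 =>
      if [pick w | onV f2 w == rng e2] is Some w
      then lam2 e2 * g2 (onV f2 w) / (g1 (onV f1 w) + g2 (onV f2 w))
      else lam2 e2
  | InBoth e0 =>
      let w := rng e0 in
      (lam1 (onE f1 e0) * g1 (onV f1 w) + lam2 (onE f2 e0) * g2 (onV f2 w))
        / (g1 (onV f1 w) + g2 (onV f2 w))
  end.

End Weight.
End GluedGraph.

(* Main.v *)
(** Call [glue_sum phi1 phi2 q] the sum of the values of [phi1] and [phi2] over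
    the (at most two) preimages of [q] in [A] and [B]. Then [glued_g] is the
    [glue_sum] of [g1] and [g2], and the coefficients [glued_lam] are chosen so
    that [lambda(e) g(r(e))] is the [glue_sum] of [lambda1(e) g1(r(e))] and
    [lambda2(e) g2(r(e))]. Pushing forward along the source maps commutes with
    gluing, so the weight equation on the glued graph is the [glue_sum] of the
    weight equations on [G1] and [G2]. *)

Require Import Defs.
From mathcomp Require Import all_boot all_order all_algebra.
From mathcomp Require Import reals.

Set Implicit Arguments.
Unset Strict Implicit.
Unset Printing Implicit Defensive.

Import Order.TTheory GRing.Theory Num.Theory.
Local Open Scope ring_scope.

Section GluedSum.
Variables (C A B : finType) (f1 : C -> A) (f2 : C -> B).
Hypotheses (f1_inj : injective f1) (f2_inj : injective f2).
Local Notation Q := (glued f1 f2).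

(** These are the three cases in which [part] has a known value; [glue_inlr] lets the classes coming
    from [C] be written through [A] alone. *)
Lemma glued_cases (P : Q -> Prop) :
    (forall a, a \notin codom f1 -> P (glue_inl a)) ->
    (forall b, b \notin codom f2 -> P (glue_inr b)) ->
    (forall c, P (glue_inl (f1 c))) ->
  forall q, P q.
Proof.
move=> Pl Pr Pb; elim/glue_ind => [a|b].
  by have [/codomP[c ->]|] := boolP (a \in codom f1); [apply: Pb|apply: Pl].
have [/codomP[c ->]|] := boolP (b \in codom f2); last exact: Pr.
by rewrite -glue_inlr; apply: Pb.
Qed.

(** [part] sends the class of [a] to [InBoth c] if [a = f1 c] and to [InLeft a] otherwise; either
    value determines [a]. *)
Lemma glue_inl_inj : injective (glue_inl : A -> Q).
Proof.
move=> a a' /(congr1 (@part _ _ _ _ _)).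
have [/codomP[c ->]|aC] := boolP (a \in codom f1);
  have [/codomP[c' ->]|a'C] := boolP (a' \in codom f1);
  by rewrite ?(part_both f1_inj f2_inj) ?(part_left f1_inj f2_inj) // => -[->].
Qed.

Lemma glue_inr_inj : injective (glue_inr : B -> Q).
Proof.
move=> b b' /(congr1 (@part _ _ _ _ _)).
have [/codomP[c ->]|bC] := boolP (b \in codom f2);
  have [/codomP[c' ->]|b'C] := boolP (b' \in codom f2);
  by rewrite -?glue_inlr ?(part_both f1_inj f2_inj)
             ?(part_right f1_inj f2_inj) // => -[->].
Qed.

Lemma glue_inl_eq_inr a b :
  glue_inl a = glue_inr b :> Q -> exists2 c, a = f1 c & b = f2 c.
Proof.
have [/codomP[c ->]|aC] := boolP (a \in codom f1).
  by rewrite glue_inlr => /glue_inr_inj <-; exists c.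
have [/codomP[c ->]|bC] := boolP (b \in codom f2).
  by rewrite -glue_inlr => /glue_inl_inj ->; exists c.
move/(congr1 (@part _ _ _ _ _)).
by rewrite (part_left f1_inj f2_inj) // (part_right f1_inj f2_inj).
Qed.

Variable V : nmodType.

Definition glue_sum (phi1 : A -> V) (phi2 : B -> V) (q : Q) : V :=
  \sum_(a | glue_inl a == q) phi1 a + \sum_(b | glue_inr b == q) phi2 b.

(** Links the sums over preimages, suited to exchanging summations, with the case distinction used
    in [glued_g] and [glued_lam]. By injectivity each sum has at most one term. *)
Lemma glue_sumE phi1 phi2 q :
  glue_sum phi1 phi2 q =
  match part q with
  | InLeft a => phi1 a
  | InRight b => phi2 b
  | InBoth c => phi1 (f1 c) + phi2 (f2 c)
  end.
Proof.
rewrite /glue_sum; elim/glued_cases: q => [a aC|b bC|c].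
- rewrite (part_left f1_inj f2_inj) //.
  rewrite (big_pred1 a) => [|x]; last by rewrite (inj_eq glue_inl_inj).
  rewrite big_pred0 ?addr0 // => b; apply/eqP => /esym/glue_inl_eq_inr[c ac _].
  by rewrite ac codom_f in aC.
- rewrite (part_right f1_inj f2_inj) //.
  rewrite [X in _ + X](big_pred1 b) => [|x]; last first.
    by rewrite (inj_eq glue_inr_inj).
  rewrite big_pred0 ?add0r // => a; apply/eqP => /glue_inl_eq_inr[c _ bc].
  by rewrite bc codom_f in bC.
rewrite (part_both f1_inj f2_inj); congr (_ + _).
  by apply: big_pred1 => a; rewrite (inj_eq glue_inl_inj).
by apply: big_pred1 => b; rewrite glue_inlr (inj_eq glue_inr_inj).
Qed.

(** Each element of [A] or [B] lies over exactly one class, so grouping by class loses and repeats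
    nothing. *)
Lemma sum_glue_sum (P : pred Q) phi1 phi2 :
  \sum_(q | P q) glue_sum phi1 phi2 q =
  \sum_(a | P (glue_inl a)) phi1 a + \sum_(b | P (glue_inr b)) phi2 b.
Proof.
rewrite big_split /=; congr (_ + _).
  rewrite (partition_big (glue_inl : A -> Q) P) //=.
  apply: eq_bigr => q Pq; apply: eq_bigl => a.
  by case: eqP => [->|]; rewrite ?Pq ?andbF.
rewrite (partition_big (glue_inr : B -> Q) P) //=.
apply: eq_bigr => q Pq; apply: eq_bigl => b.
by case: eqP => [->|]; rewrite ?Pq ?andbF.
Qed.

End GluedSum.

Section GluedWeight.
Variables (R : realType) (G G1 G2 : digraph).
Variables (f1 : embedding G G1) (f2 : embedding G G2).
Variables (g1 : vertex G1 -> R) (lam1 : edge G1 -> R).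
Variables (g2 : vertex G2 -> R) (lam2 : edge G2 -> R).

Let V1 := @onV_inj _ _ f1.
Let V2 := @onV_inj _ _ f2.
Let E1 := @onE_inj _ _ f1.
Let E2 := @onE_inj _ _ f2.

Local Notation GG := (glued_graph f1 f2).
Local Notation g := (glued_g g1 g2 : vertex GG -> R).
Local Notation lam := (glued_lam g1 lam1 g2 lam2 : edge GG -> R).

Lemma glued_gE : g =1 glue_sum g1 g2.
Proof. by move=> v; rewrite (glue_sumE V1 V2). Qed.

Section Positive.
Hypotheses (g1_gt0 : forall v, 0 < g1 v) (g2_gt0 : forall v, 0 < g2 v).

Lemma glued_g_gt0 v : 0 < g v.
Proof. by rewrite /glued_g; case: part => // w; apply: addr_gt0. Qed.

Lemma glued_lam_ge0 e :
  (forall e, 0 <= lam1 e) -> (forall e, 0 <= lam2 e) -> 0 <= lam e.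
Proof.
move=> lam1_ge0 lam2_ge0.
have g1_ge0 v : 0 <= g1 v by apply: ltW.
have g2_ge0 v : 0 <= g2 v by apply: ltW.
rewrite /glued_lam; case: part => [e1|e2|e0] /=; last first.
- by rewrite divr_ge0 ?addr_ge0 ?mulr_ge0.
- by case: pickP => // w _; rewrite divr_ge0 ?addr_ge0 ?mulr_ge0.
by case: pickP => // w _; rewrite divr_ge0 ?addr_ge0 ?mulr_ge0.
Qed.

(** If the range of [e] is in [G], the denominator of [lam e] is exactly [g (rng e)] and cancels. *)
Lemma glued_lam_mul_g e :
  lam e * g (rng e) =
  glue_sum (fun e1 => lam1 e1 * g1 (rng e1))
           (fun e2 => lam2 e2 * g2 (rng e2)) e.
Proof.
have g12_neq0 w : g1 (onV f1 w) + g2 (onV f2 w) != 0.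
  by rewrite gt_eqF ?addr_gt0.
rewrite (glue_sumE E1 E2) /= /glued_lam.
elim/glued_cases: e => [e1 e1G|e2 e2G|e0].
- rewrite (part_left E1 E2) // glued_rng_inl /glued_g.
  case: pickP => [w /eqP <-|rG]; first by rewrite (part_both V1 V2) mulfVK.
  (* The failed [pick] puts the range outside [G], where [g] is [g1] alone. *)
  by rewrite (part_left V1 V2) //; apply/codomP => -[w /esym/eqP]; rewrite rG.
- rewrite (part_right E1 E2) // glued_rng_inr /glued_g.
  case: pickP => [w /eqP <-|rG].
    by rewrite -glue_inlr (part_both V1 V2) mulfVK.
  by rewrite (part_right V1 V2) //; apply/codomP => -[w /esym/eqP]; rewrite rG.
rewrite (part_both E1 E2) glued_rng_inl /= !onE_rng /glued_g.
by rewrite (part_both V1 V2) mulfVK.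
Qed.

End Positive.

(** An edge leaving [v] comes from [G1] or [G2]. On its own side, the preimage of [v] is its source;
    a preimage on the other side forces [v] into [G], and [hsink] transfers the property. *)
Lemma sink_glued :
    (forall v : vertex G, sink (onV f1 v) = sink (onV f2 v)) ->
  forall v : vertex GG, ~~ sink v ->
  (forall v1, glue_inl v1 = v -> ~~ sink v1) /\
  (forall v2, glue_inr v2 = v -> ~~ sink v2).
Proof.
move=> hsink v; rewrite /sink negbK => /existsP[e /eqP <- {v}].
have nsink (H : digraph) (a : edge H) : ~~ sink (src a).
  by rewrite /sink negbK; apply/existsP; exists a.
elim/glue_ind: e => [e1|e2].
  rewrite /= glued_src_inl; split=> [v1 /(glue_inl_inj V1 V2) ->|v2].
    exact: nsink.
  move/esym/(glue_inl_eq_inr V1 V2) => [w e1w ->].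
  by rewrite -/(sink _) -hsink -e1w nsink.
rewrite /= glued_src_inr; split=> [v1|v2 /(glue_inr_inj V1 V2) ->].
  move/(glue_inl_eq_inr V1 V2) => [w -> e2w].
  by rewrite -/(sink _) hsink -e2w nsink.
exact: nsink.
Qed.

(** Both sides run over the edges of [G1] and [G2] whose source lies over [v]; the right side groups
    them by source. *)
Lemma sum_src_glue_sum (phi1 : edge G1 -> R) (phi2 : edge G2 -> R)
    (v : vertex GG) :
  \sum_(e : edge GG | src e == v) glue_sum phi1 phi2 e =
  glue_sum (fun v1 => \sum_(e1 | src e1 == v1) phi1 e1)
           (fun v2 => \sum_(e2 | src e2 == v2) phi2 e2) v.
Proof.
rewrite sum_glue_sum /glue_sum; congr (_ + _).
  rewrite (partition_big src (fun v1 => glue_inl v1 == v)) => [|e1] /=.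
    apply: eq_bigr => v1 /eqP v1v; apply: eq_bigl => e1.
    by rewrite glued_src_inl; case: (src e1 =P v1) => [->|];
      rewrite ?andbF ?v1v ?eqxx.
  by rewrite glued_src_inl.
rewrite (partition_big src (fun v2 => glue_inr v2 == v)) => [|e2] /=.
  apply: eq_bigr => v2 /eqP v2v; apply: eq_bigl => e2.
  by rewrite glued_src_inr; case: (src e2 =P v2) => [->|];
    rewrite ?andbF ?v2v ?eqxx.
by rewrite glued_src_inr.
Qed.

End GluedWeight.

(* [hsink] is needed because the weight equation is not imposed at sinks: if a
   vertex [v] of [G] is a sink in [G1] but not in [G2], the glued graph has at
   [v] only the edges of [G2], whose contributions add up to [g2 v] and not to
   [g1 v + g2 v]. *)
Theorem proposition5p1 (R : realType) (G G1 G2 : digraph)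
    (f1 : embedding G G1) (f2 : embedding G G2)
    (g1 : vertex G1 -> R) (lam1 : edge G1 -> R)
    (g2 : vertex G2 -> R) (lam2 : edge G2 -> R)
    (hw1 : faithful_graph_weight g1 lam1)
    (hw2 : faithful_graph_weight g2 lam2)
    (hsink : forall v : vertex G, sink (onV f1 v) = sink (onV f2 v)) :
  faithful_graph_weight (G := glued_graph f1 f2)
    (glued_g g1 g2) (glued_lam g1 lam1 g2 lam2).
Proof.
have gt0 (H : digraph) (h : vertex H -> R) mu :
    faithful_graph_weight h mu -> forall v, 0 < h v.
  by move=> [[h_ge0 _ _] h_neq0] v; rewrite lt_def h_neq0 h_ge0.
have g1_gt0 := gt0 _ _ _ hw1; have g2_gt0 := gt0 _ _ _ hw2.
have [[_ lam1_ge0 g1E] _] := hw1; have [[_ lam2_ge0 g2E] _] := hw2.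
split; last by move=> v; rewrite gt_eqF ?glued_g_gt0.
split=> [v|e|v v_nsink]; first exact/ltW/glued_g_gt0.
  exact: glued_lam_ge0.
under eq_bigr do rewrite glued_lam_mul_g //.
have [nsink1 nsink2] := sink_glued hsink v_nsink.
(* Both sides become sums over the preimages of [v]. None of these is a sink, so their own weight
   equations match the terms. *)
rewrite sum_src_glue_sum glued_gE /glue_sum; congr (_ + _).
  by apply: eq_bigr => v1 /eqP/nsink1/g1E.
by apply: eq_bigr => v2 /eqP/nsink2/g2E.
Qed.
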